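(* Let $f:\mathbb{R}^n\to\mathbb{R}$ be of class $C^{2+}$ with $L_f$-Lipschitz continuous gradient, let $g:\mathbb{R}^n\to\mathbb{R}\cup\{+\infty\}$ be proper, lower semicontinuous and $\rho$-weakly convex, let $\varphi=f+g$ with $\operatorname{argmin}\varphi\neq\emptyset$, and suppose $\{x:\varphi(x)\le\varphi(x^0)\}$ is bounded. Let $(x^k)_{k\in\mathbb N}$ be generated by the NTRA algorithm described in the context, and suppose that there is $\beta\in(0,1)$ such that for all $k$, $$m_k(0)-m_k(d^k)\ge\beta\|\nabla\varphi_\gamma(x^k)\|\min\Big\{\delta_k,\frac{\|\nabla\varphi_\gamma(x^k)\|}{\|B_k\|}\Big\}.$$ Then $\lim_{k\to\infty}\|\nabla\varphi_\gamma(x^k)\|=0$.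
   Context: $C^{2+}$: twice continuously differentiable with locally Lipschitz Hessian; $g$ is $\rho$-weakly convex if $g+\frac\rho2\|\cdot\|^2$ is convex. $\operatorname{prox}_{\gamma g}(x)=\operatorname{argmin}_z\{g(z)+\frac1{2\gamma}\|z-x\|^2\}$, $R_\gamma(x)=\gamma^{-1}(x-\operatorname{prox}_{\gamma g}(x-\gamma\nabla f(x)))$, forward-backward envelope $\varphi_\gamma(x)=\inf_u\{f(x)+\langle\nabla f(x),u-x\rangle+g(u)+\frac1{2\gamma}\|u-x\|^2\}$ (continuously differentiable here). $\partial_C$ denotes the Clarke generalized Jacobian. NTRA: given $x^0$, $\gamma\in(0,\min\{1/L_f,1/\rho\})$, $\delta_0>0$, $0<\mu_1<\mu_2<1$, $0<c_1<c_2<1<c_3$; for $k=0,1,\dots$: select $P_k\in\partial_C\operatorname{prox}_{\gamma g}(x^k-\gamma\nabla f(x^k))$; set $Q_k=I-\gamma\nabla^2f(x^k)$, $B_k=\gamma^{-1}Q_k(I-P_kQ_k)$; stop if $R_\gamma(x^k)=0$ and $\lambda_{\min}(B_k)\ge0$; let $d^k$ be an (approximate) solution of $\min_d m_k(d):=\varphi_\gamma(x^k)+\langle\nabla\varphi_\gamma(x^k),d\rangle+\frac12\langle B_kd,d\rangle$ s.t. $\|d\|\le\delta_k$; compute $\rho_k=\frac{\varphi_\gamma(x^k)-\varphi_\gamma(x^k+d^k)}{m_k(0)-m_k(d^k)}$; set $x^{k+1}=x^k$ if $\rho_k<\mu_1$, else $x^{k+1}=x^k+d^k$; update $\delta_{k+1}=c_1\delta_k$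 if $\rho_k<\mu_1$, $c_2\delta_k$ if $\mu_1\le\rho_k<\mu_2$, $c_3\delta_k$ if $\rho_k\ge\mu_2$. *)

(* Defs.v *)
From HB Require Import structures.
From mathcomp Require Import all_boot all_order all_algebra.
From mathcomp Require Import all_classical all_reals all_analysis.
Set Implicit Arguments. Unset Strict Implicit. Unset Printing Implicit Defensive.
Import Order.TTheory GRing.Theory Num.Theory.
Import numFieldNormedType.Exports.
Local Open Scope classical_set_scope.
Local Open Scope ring_scope.

Section NTRA.
Variables (R : realType) (n : nat).
Local Notation vec := 'cV[R]_n.
Local Notation mat := 'M[R]_n.

Definition dotv (u v : vec) : R := \sum_(i < n) u i 0 * v i 0.
Definition enorm (u : vec) : R := Num.sqrt (dotv u u).

Definition opnorm (A : mat) : R :=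
  sup [set enorm (A *m v) | v in [set v : vec | enorm v <= 1]].

Definition grad (f : vec -> R) (x : vec) : vec :=
  \col_(i < n) ('d f x (delta_mx i 0 : vec)).
Definition jac (F : vec -> vec) (x : vec) : mat :=
  \matrix_(i < n, j < n) ('d F x (delta_mx j 0 : vec)) i 0.
Definition hess (f : vec -> R) (x : vec) : mat := jac (grad f) x.

Definition C2plus (f : vec -> R) : Prop :=
  (forall x, differentiable f x) /\
  (forall x, differentiable (grad f) x) /\
  continuous (hess f) /\
  (forall x, exists2 r : R, 0 < r & exists L : R, forall y z,
      enorm (y - x) < r -> enorm (z - x) < r ->
      opnorm (hess f y - hess f z) <= L * enorm (y - z)).

Definition lipschitz_grad (f : vec -> R) (Lf : R) : Prop :=
  forall x y, enorm (grad f x - grad f y) <= Lf * enorm (x - y).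

Definition proper_fun (g : vec -> \bar R) : Prop :=
  (exists x, g x < +oo)%E /\ (forall x, -oo < g x)%E.

Definition weakly_convex (rho : R) (g : vec -> \bar R) : Prop :=
  let h := fun z => (g z + (rho / 2 * enorm z ^+ 2)%:E)%E in
  forall (x y : vec) (t : R), 0 < t < 1 ->
    let z : vec := (t *: x + (1 - t) *: y)%R in
    (h z <= t%:E * h x + (1 - t)%:E * h y)%E.

Definition is_prox (gamma : R) (g : vec -> \bar R) (p : vec -> vec) : Prop :=
  forall x z, (g (p x) + (1 / (2 * gamma) * enorm (p x - x) ^+ 2)%:E
               <= g z + (1 / (2 * gamma) * enorm (z - x) ^+ 2)%:E)%E.

Definition Rgam (gamma : R) (f : vec -> R) (p : vec -> vec) (x : vec) : vec :=
  gamma^-1 *: (x - p (x - gamma *: grad f x)).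

Definition fbe (gamma : R) (f : vec -> R) (g : vec -> \bar R) (x : vec) : R :=
  fine (ereal_inf (range (fun u : vec =>
    ((f x + dotv (grad f x) (u - x) + 1 / (2 * gamma) * enorm (u - x) ^+ 2)%:E
      + g u)%E))).

Definition BJac (F : vec -> vec) (x : vec) : set mat :=
  [set M | exists y : nat -> vec,
      (forall k, differentiable F (y k)) /\ y @ \oo --> x /\
      (fun k => jac F (y k)) @ \oo --> M].
Definition ClarkeJac (F : vec -> vec) (x : vec) : set mat :=
  [set M | exists (m : nat) (lam : 'I_m -> R) (Ms : 'I_m -> mat),
      (forall i, 0 <= lam i) /\ \sum_(i < m) lam i = 1 /\
      (forall i, BJac F x (Ms i)) /\ M = \sum_(i < m) lam i *: Ms i].

Definition model (phik : R) (gk : vec) (B : mat) (d : vec) : R :=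
  phik + dotv gk d + 1 / 2 * dotv (B *m d) d.

(* min{delta, a / ||B||}, with a/0 read as +infinity *)
Definition cauchy_min (delta a : R) (B : mat) : R :=
  if opnorm B == 0 then delta else Num.min delta (a / opnorm B).

End NTRA.

(* Main.v *)
Require Import Defs.
From HB Require Import structures.
From mathcomp Require Import all_boot all_order all_algebra.
From mathcomp Require Import all_classical all_reals all_analysis.
From mathcomp Require Import ring lra.

Set Implicit Arguments. Unset Strict Implicit. Unset Printing Implicit Defensive.
Import Order.TTheory GRing.Theory Num.Theory.
Import numFieldNormedType.Exports.
Local Open Scope classical_set_scope.
Local Open Scope ring_scope.

(** The forward-backward envelope is [phi_gamma x = E x (T x) + g (T x)] with
    [T x = prox (x - gamma grad f x)] and [E] smooth in [x].  Since [T] is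
    Lipschitz and minimizes [E x + g], freezing [T] changes the increment of
    [phi_gamma] only to second order, so its gradient is
    [gamma^-1 (x - T x) - (hess f x)^T (x - T x)]; symmetry of the Hessian is not
    needed.  This gradient is uniformly continuous on bounded sets, and [B_k] is
    bounded because [hess f] is bounded by [Lf] and Clarke Jacobians of [prox] by
    its Lipschitz constant.  The descent lemma bounds the sublevel set of
    [phi_gamma], hence the iterates.  Then the classical trust-region argument
    applies: a small radius at a point with gradient at least [e] forces a very
    successful step, so radii cannot shrink while the gradient stays above [e]
    and its liminf is zero; and while the gradient exceeds [e] the distance
    travelled is controlled by the decrease of [phi_gamma], so that it cannot
    oscillate. *)

Lemma addr_subC (V : zmodType) (x y : V) : x + y - x = y.
Proof. by rewrite addrAC subrr add0r. Qed.

(** * Euclidean norm *)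

Section Euclid.
Context {R : realType} {n : nat}.
Implicit Types (u v w x y z : 'cV[R]_n) (A B : 'M[R]_n) (a b : R).

Lemma dotvC u v : dotv u v = dotv v u.
Proof. by apply: eq_bigr => i _; rewrite mulrC. Qed.

Lemma dotvDl u v w : dotv (u + v) w = dotv u w + dotv v w.
Proof. by rewrite -big_split; apply: eq_bigr => i _; rewrite mxE mulrDl. Qed.

Lemma dotvZl a u v : dotv (a *: u) v = a * dotv u v.
Proof. by rewrite mulr_sumr; apply: eq_bigr => i _; rewrite mxE mulrA. Qed.

Lemma dotvDr u v w : dotv u (v + w) = dotv u v + dotv u w.
Proof. by rewrite dotvC dotvDl !(dotvC u). Qed.

Lemma dotvZr a u v : dotv u (a *: v) = a * dotv u v.
Proof. by rewrite dotvC dotvZl (dotvC u). Qed.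

Lemma dotvNl u v : dotv (- u) v = - dotv u v.
Proof. by rewrite -scaleN1r dotvZl mulN1r. Qed.

Lemma dotvBl u v w : dotv (u - v) w = dotv u w - dotv v w.
Proof. by rewrite dotvDl dotvNl. Qed.

Lemma dotvNr u v : dotv u (- v) = - dotv u v.
Proof. by rewrite dotvC dotvNl (dotvC u). Qed.

Lemma dotv0l u : dotv 0 u = 0.
Proof. by rewrite -(scale0r u) dotvZl mul0r. Qed.

Lemma dotv0r u : dotv u 0 = 0.
Proof. by rewrite dotvC dotv0l. Qed.

Definition dotvE := (dotvDl, dotvDr, dotvNl, dotvNr, dotvZl, dotvZr).

Lemma dotv_mulmx_tr A u v : dotv (A *m u) v = dotv u (A^T *m v).
Proof.
rewrite /dotv; under eq_bigr => i _ do rewrite mxE mulr_suml.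
rewrite exchange_big; apply: eq_bigr => j _; rewrite mxE mulr_sumr.
by apply: eq_bigr => i _; rewrite mxE; ring.
Qed.

Lemma dotv_ge0 u : 0 <= dotv u u.
Proof. by apply: sumr_ge0 => i _; rewrite -expr2 sqr_ge0. Qed.

Lemma sqr_enorm u : enorm u ^+ 2 = dotv u u.
Proof. by rewrite sqr_sqrtr // dotv_ge0. Qed.

Lemma enorm_ge0 u : 0 <= enorm u.
Proof. exact: sqrtr_ge0. Qed.

Lemma abs_coord_le_enorm u i : `|u i 0| <= enorm u.
Proof.
rewrite -sqrtr_sqr ler_wsqrtr // expr2 /dotv (bigD1 i) //= lerDl.
by apply: sumr_ge0 => j _; rewrite -expr2 sqr_ge0.
Qed.

Lemma enorm_eq0 u : enorm u = 0 -> u = 0.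
Proof.
move=> u0; apply/colP => i; rewrite mxE; apply/eqP; rewrite -normr_le0 -u0.
exact: abs_coord_le_enorm.
Qed.

Lemma enorm0 : enorm (0 : 'cV[R]_n) = 0.
Proof. by rewrite /enorm dotv0l sqrtr0. Qed.

Lemma enormZ a u : enorm (a *: u) = `|a| * enorm u.
Proof. by rewrite /enorm dotvZl dotvZr mulrA sqrtrM -?expr2 ?sqr_ge0 // sqrtr_sqr. Qed.

Lemma enormN u : enorm (- u) = enorm u.
Proof. by rewrite -scaleN1r enormZ normrN1 mul1r. Qed.

Lemma enormC u v : enorm (u - v) = enorm (v - u).
Proof. by rewrite -enormN opprB. Qed.

Lemma abs_dotv_le u v : `|dotv u v| <= enorm u * enorm v.
Proof.
have uv2 : dotv u v ^+ 2 <= dotv u u * dotv v v.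
  have [v0|v0] := eqVneq v 0; first by rewrite v0 !dotv0r mulr0 expr0n.
  have vv : 0 < dotv v v.
    rewrite lt_def dotv_ge0 andbT; apply: contraNneq v0 => vv0.
    by apply/eqP/enorm_eq0; rewrite /enorm vv0 sqrtr0.
  (* The squared norm of this vector is [dotv v v] times the Gram determinant of [u] and [v], so
     that determinant is nonnegative. *)
  have := dotv_ge0 (dotv v v *: u - dotv u v *: v).
  rewrite !dotvE (dotvC v u).
  rewrite [X in 0 <= X -> _](_ : _ =
    dotv v v * (dotv u u * dotv v v - dotv u v ^+ 2)); last by ring.
  by rewrite pmulr_rge0 // subr_ge0.
by rewrite -sqrtr_sqr -sqrtrM ?dotv_ge0 // ler_wsqrtr.
Qed.

Lemma dotv_le u v : dotv u v <= enorm u * enorm v.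
Proof. exact: le_trans (ler_norm _) (abs_dotv_le u v). Qed.

Lemma enormD u v : enorm (u + v) <= enorm u + enorm v.
Proof.
rewrite -(@ler_pXn2r _ 2) ?nnegrE ?addr_ge0 ?enorm_ge0 //.
rewrite sqr_enorm !dotvE (dotvC v u) sqrrD !sqr_enorm.
by have := dotv_le u v; lra.
Qed.

Lemma enormB u v : enorm (u - v) <= enorm u + enorm v.
Proof. by rewrite -(enormN v) enormD. Qed.

Lemma enorm_le_add u v : enorm u <= enorm v + enorm (u - v).
Proof. by rewrite -[X in enorm X <= _](subrK v) addrC enormD. Qed.

Lemma enorm_trans u v w : enorm (u - w) <= enorm (u - v) + enorm (v - w).
Proof. by rewrite -(subrKA v u (- w)) enormD. Qed.

Lemma norm_coord_le m k (M : 'M[R]_(m, k)) i j : `|M i j| <= `|M|.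
Proof.
rewrite [leRHS]/Num.Def.normr /= mx_normrE; apply/bigmax_geP.
by right; exists (i, j).
Qed.

Lemma norm_mx_le m k (M : 'M[R]_(m, k)) a :
  0 <= a -> (forall i j, `|M i j| <= a) -> `|M| <= a.
Proof.
move=> a0 Ma; rewrite [leLHS]/Num.Def.normr /= mx_normrE.
by rewrite (bigmax_le _ a0) // => -[i j] _.
Qed.

(** The library norm of a column is its largest entry in absolute value. This bound and
    [enorm_le_norm] carry neighbourhoods and remainders between that norm and the Euclidean one. *)
Lemma norm_le_enorm u : `|u| <= enorm u.
Proof.
apply: norm_mx_le (enorm_ge0 u) _ => i j; rewrite (ord1 j).
exact: abs_coord_le_enorm.
Qed.

Lemma enorm_delta i : enorm (delta_mx i 0 : 'cV[R]_n) = 1.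
Proof.
rewrite /enorm /dotv (bigD1 i) //= big1 => [|j /negPf ji].
  by rewrite !mxE !eqxx mulr1 addr0 sqrtr1.
by rewrite !mxE ji mul0r.
Qed.

Lemma cV_delta_sum u : u = \sum_i u i 0 *: delta_mx i 0.
Proof. by rewrite {1}(matrix_sum_delta u); apply: eq_bigr => i _; rewrite big_ord1. Qed.

Lemma enorm_sum (I : Type) (r : seq I) (F : I -> 'cV[R]_n) :
  enorm (\sum_(i <- r) F i) <= \sum_(i <- r) enorm (F i).
Proof.
elim/big_ind2: _ => [||//]; first by rewrite enorm0.
by move=> u a v b ua vb; apply: le_trans (enormD _ _) (lerD ua vb).
Qed.

Lemma enorm_le_norm u : enorm u <= n%:R * `|u|.
Proof.
rewrite {1}(cV_delta_sum u); apply: le_trans (enorm_sum _ _) _.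
have -> : n%:R * `|u| = \sum_(i < n) `|u| by rewrite sumr_const card_ord mulr_natl.
by apply: ler_sum => i _; rewrite enormZ enorm_delta mulr1 norm_coord_le.
Qed.

(** One factor [n] pays for passing from the largest entry to the Euclidean norm, the other for the
    number of summands in an entry of [A *m u]. *)
Lemma enorm_mulmx_le_norm A u : enorm (A *m u) <= n%:R ^+ 2 * `|A| * enorm u.
Proof.
apply: le_trans (enorm_le_norm _) _.
rewrite expr2 -!mulrA; apply: ler_wpM2l => //.
rewrite mulrA; apply: norm_mx_le => [|i j]; first by rewrite !mulr_ge0 // enorm_ge0.
rewrite mxE; apply: le_trans (ler_norm_sum _ _ _) _.
have -> : n%:R * `|A| * enorm u = \sum_(k < n) `|A| * enorm u.
  by rewrite sumr_const card_ord mulr_natl mulrnAl.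
apply: ler_sum => k _; rewrite normrM (ord1 j).
by apply: ler_pM => //; [exact: norm_coord_le | exact: abs_coord_le_enorm].
Qed.

Lemma norm_trmx A : `|A^T| <= `|A|.
Proof. by apply: norm_mx_le => // i j; rewrite mxE norm_coord_le. Qed.

(** An inequality instead of [opnorm]: such bounds add and compose directly, while a supremum is
    informative only once its set is known to be bounded. *)
Definition opbound A a := forall v, enorm (A *m v) <= a * enorm v.

Lemma opnorm_bounds A a : 0 <= a -> opbound A a -> 0 <= opnorm A <= a.
Proof.
move=> a0 Aa; rewrite /opnorm; set S := [set _ | _ in _].
have S0 : S 0 by exists 0; rewrite /= ?mulmx0 enorm0.
have Sa : ubound S a.
  move=> _ [v /= v1 <-]; apply: le_trans (Aa v) _.
  by rewrite -{2}(mulr1 a) ler_wpM2l.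
rewrite sup_le_ub //; last by exists 0.
by rewrite andbT; apply: ub_le_sup => //; exists a.
Qed.

Lemma opboundD A B a b : opbound A a -> opbound B b -> opbound (A + B) (a + b).
Proof. by move=> Aa Bb v; rewrite mulmxDl mulrDl (le_trans (enormD _ _)) ?lerD. Qed.

Lemma opboundZ A a b : opbound A a -> opbound (b *: A) (`|b| * a).
Proof. by move=> Aa v; rewrite -scalemxAl enormZ -mulrA ler_wpM2l. Qed.

Lemma opboundN A a : opbound A a -> opbound (- A) a.
Proof. by move=> Aa v; rewrite mulNmx enormN. Qed.

Lemma opboundM A B a b : 0 <= a -> opbound A a -> opbound B b -> opbound (A *m B) (a * b).
Proof.
by move=> a0 Aa Bb v; rewrite -mulmxA -mulrA (le_trans (Aa _)) // ler_wpM2l.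
Qed.

Lemma opbound1 : opbound 1%:M 1.
Proof. by move=> v; rewrite mul1mx mul1r. Qed.

(** In |A^T v|^2 = <A A^T v, v>, Cauchy-Schwarz leaves a factor |A^T v| to cancel. *)
Lemma opbound_tr A a : 0 <= a -> opbound A a -> opbound A^T a.
Proof.
move=> a0 Aa v; have := enorm_ge0 (A^T *m v); rewrite le_eqVlt => /orP[/eqP <-|pos].
  by rewrite mulr_ge0 ?enorm_ge0.
rewrite -(ler_pM2l pos) -expr2 sqr_enorm -dotv_mulmx_tr (le_trans (dotv_le _ _)) //.
by rewrite mulrA (mulrC _ a) ler_wpM2r ?enorm_ge0.
Qed.

End Euclid.

(** * Gradients and Jacobians in the Euclidean norm *)

Section Calculus.
Context {R : realType} {n : nat}.
Implicit Types (f : 'cV[R]_n -> R) (F : 'cV[R]_n -> 'cV[R]_n) (x d q : 'cV[R]_n).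

(** Differentiability with gradient [q], in epsilon-delta form and in the Euclidean norm. It does
    not refer to ['d f x], whose value is meaningful only once differentiability is known. *)
Definition has_grad f x q := forall e : R, 0 < e ->
  exists2 r : R, 0 < r & forall h, enorm h < r ->
    `|f (x + h) - f x - dotv q h| <= e * enorm h.

Lemma differentiable_eps (W : normedModType R) (F : 'cV[R]_n -> W) x e :
  differentiable F x -> 0 < e -> exists2 r : R, 0 < r & forall h, enorm h < r ->
    `|F (x + h) - F x - 'd F x h| <= e * enorm h.
Proof.
move=> /diff_locally /eqaddoP dF e0.
have /nbhs_ballP[r /= r0 Hr] := dF e e0.
exists r => // h hr; have := Hr h.
rewrite -ball_normE /= sub0r normrN => /(_ (le_lt_trans (norm_le_enorm h) hr)).
rewrite /= !fctE /= opprD addrA (addrC h) => /le_trans; apply.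
by rewrite ler_wpM2l ?norm_le_enorm // ltW.
Qed.

Lemma diff_dotv_grad f x h : 'd f x h = dotv (grad f x) h.
Proof.
rewrite {1}(cV_delta_sum h) linear_sum /dotv; apply: eq_bigr => i _.
by rewrite linearZ mxE mulrC.
Qed.

Lemma diff_mulmx_jac F x h : 'd F x h = jac F x *m h.
Proof.
rewrite {1}(cV_delta_sum h) linear_sum; apply/colP => i.
rewrite summxE mxE; apply: eq_bigr => j _.
by rewrite linearZ /= !mxE mulrC.
Qed.

Lemma has_grad_grad f x : differentiable f x -> has_grad f x (grad f x).
Proof.
move=> dfx e e0; have [r r0 Hr] := differentiable_eps dfx e0.
by exists r => // h hr; rewrite -diff_dotv_grad Hr.
Qed.

Lemma jac_eps F x e : differentiable F x -> 0 < e ->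
  exists2 r : R, 0 < r & forall h, enorm h < r ->
    enorm (F (x + h) - F x - jac F x *m h) <= e * enorm h.
Proof.
(* [n.+1] keeps the divisor nonzero in dimension 0. *)
move=> dFx e0; have n0 : 0 < n.+1%:R :> R by rewrite ltr0n.
have [r r0 Hr] := differentiable_eps dFx (divr_gt0 e0 n0).
exists r => // h hr; rewrite -diff_mulmx_jac; apply: le_trans (enorm_le_norm _) _.
apply: (@le_trans _ _ (n.+1%:R * (e / n.+1%:R * enorm h))).
  by apply: ler_pM => //; [rewrite ler_nat | exact: Hr].
by rewrite mulrA mulrCA mulfV ?gt_eqF // mulr1.
Qed.

(** [dotv q] is packed as a continuous linear map with a little-o remainder, so uniqueness of the
    differential identifies it with ['d f x]. *)
Lemma has_grad_unique f x q : has_grad f x q -> grad f x = q.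
Proof.
move=> fq; have lq : linear (dotv q) by move=> a u v; rewrite dotvDr dotvZr.
pose lM := GRing.isLinear.Build _ _ _ _ _ lq.
pose L : {linear 'cV[R]_n -> R} := HB.pack (dotv q) lM.
have cL : continuous L.
  apply/linear_bounded_continuous/linear_boundedP; exists (enorm q * n%:R).
  split=> [|b qb v]; first exact: num_real.
  apply: le_trans (abs_dotv_le q v) _.
  apply: (@le_trans _ _ (enorm q * (n%:R * `|v|))).
    by rewrite ler_wpM2l ?enorm_ge0 ?enorm_le_norm.
  by rewrite mulrA ler_wpM2r // ltW.
have n0 : 0 < n.+1%:R :> R by rewrite ltr0n.
have dL : f \o shift x = cst (f x) + L +o_ (0 : 'cV[R]_n) id.
  apply/eqaddoP => e e0.
  have [r r0 Hr] := fq _ (divr_gt0 e0 n0).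
  apply/nbhs_ballP; exists (r / n.+1%:R) => /=; first exact: divr_gt0.
  move=> h; rewrite -ball_normE /= sub0r normrN ltr_pdivlMr // => hr.
  have nh : enorm h <= n.+1%:R * `|h|.
    by apply: le_trans (enorm_le_norm h) _; rewrite ler_wpM2r // ler_nat.
  have := Hr h; rewrite !fctE /= opprD addrA (addrC h).
  rewrite mulrC in hr; move=> /(_ (le_lt_trans nh hr)) /le_trans; apply.
  apply: (@le_trans _ _ (e / n.+1%:R * (n.+1%:R * `|h|))).
    by rewrite ler_wpM2l // ltW // divr_gt0.
  by rewrite mulrA divfK ?gt_eqF.
have dE : 'd f x = L :> (_ -> _) by apply: diff_unique.
apply/colP => i; rewrite mxE dE /= /dotv (bigD1 i) //= big1 => [|j /negPf ji].
  by rewrite mxE !eqxx mulr1 addr0.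
by rewrite mxE ji mulr0.
Qed.

Lemma has_gradD f1 f2 x q1 q2 : has_grad f1 x q1 -> has_grad f2 x q2 ->
  has_grad (fun z => f1 z + f2 z) x (q1 + q2).
Proof.
move=> H1 H2 e e0; have e20 : 0 < e / 2 by rewrite divr_gt0.
have [r1 r10 {}H1] := H1 _ e20; have [r2 r20 {}H2] := H2 _ e20.
exists (Num.min r1 r2) => [|h]; first by rewrite lt_min r10.
rewrite lt_min => /andP[/H1 h1 /H2 h2].
rewrite dotvDl (_ : _ - _ = (f1 (x + h) - f1 x - dotv q1 h) +
  (f2 (x + h) - f2 x - dotv q2 h)); last by ring.
by apply: le_trans (ler_normD _ _) _; rewrite (splitr e) mulrDl lerD.
Qed.

Lemma has_grad_quad_remainder f x q C : 0 <= C ->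
  (forall e, 0 < e -> exists2 r : R, 0 < r & forall h, enorm h < r ->
    `|f (x + h) - f x - dotv q h| <= e * enorm h + C * enorm h ^+ 2) ->
  has_grad f x q.
Proof.
move=> C0 H e e0; have C10 : 0 < C + 1 by rewrite ltr_wpDl.
have e20 : 0 < e / 2 by rewrite divr_gt0.
have [r r0 Hr] := H _ e20.
(* The second radius makes C |h| at most e/2; the [+ 1] covers C = 0. *)
exists (Num.min r (e / 2 / (C + 1))) => [|h]; first by rewrite lt_min r0 divr_gt0.
rewrite lt_min ltr_pdivlMr // => /andP[/Hr hr he].
apply: le_trans hr _; rewrite expr2 mulrA -mulrDl ler_wpM2r ?enorm_ge0 //.
by have := enorm_ge0 h; lra.
Qed.

Lemma has_grad_half_sqr_dist (a : R) c x :
  has_grad (fun z => a / 2 * enorm (z - c) ^+ 2) x (a *: (x - c)).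
Proof.
apply: (@has_grad_quad_remainder _ _ _ `|a / 2|) => // e e0; exists 1 => // h _.
rewrite (addrAC x h) !sqr_enorm dotvZl; set u := x - c.
rewrite dotvDl !(dotvDr _ u) (dotvC h u).
rewrite [X in `|X| <= _](_ : _ = a / 2 * dotv h h); last by field.
by rewrite normrM (ger0_norm (dotv_ge0 h)) lerDr mulr_ge0 ?enorm_ge0 // ltW.
Qed.

Lemma is_derive_line f x d t q : has_grad f (x + t *: d) q ->
  is_derive t 1 (fun s : R => f (x + s *: d)) (dotv q d).
Proof.
move=> fq.
have C : (fun h : R => h^-1 *: (f (x + (h *: 1 + t) *: d) - f (x + t *: d))) @ 0^' -->
    dotv q d.
  apply/cvgrPdist_le => e e0.
  have d0 : 0 < enorm d + 1 by rewrite ltr_wpDl ?enorm_ge0.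
  have [r r0 Hr] := fq _ (divr_gt0 e0 d0).
  near=> h.
  have h0 : h != 0 by near: h; exact: nbhs_dnbhs_neq.
  have hr : `|h| < r / (enorm d + 1).
    by near: h; apply: dnbhs0_lt; rewrite divr_gt0.
  have hd : enorm (h *: d) < r.
    rewrite enormZ; rewrite ltr_pdivlMr // in hr; apply: le_lt_trans hr.
    by rewrite ler_wpM2l // lerDl.
  have {Hr} := Hr _ hd.
  have -> : x + (h *: 1 + t) *: d = x + t *: d + h *: d.
    by rewrite [h *: 1]mulr1 scalerDl -addrA (addrC (h *: d)).
  rewrite dotvZr enormZ => H.
  rewrite distrC -[_ *: _]/(_ * _) -(ler_pM2l (_ : 0 < `|h|)) ?normr_gt0 //.
  rewrite -normrM mulrBr mulVKf // (le_trans H) //.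
  rewrite mulrCA ler_wpM2l // -mulrA ler_piMr // ?ltW //.
  by rewrite mulrC ltr_pdivrMr // mul1r ltrDl.
apply: DeriveDef; last exact: cvg_lim C.
by apply/cvg_ex; exists (dotv q d).
Unshelve. all: by end_near. Qed.

Lemma mvt_line f (q : 'cV[R]_n -> 'cV[R]_n) x d :
  (forall z, has_grad f z (q z)) ->
  exists2 c : R, 0 <= c <= 1 & f (x + d) - f x = dotv (q (x + c *: d)) d.
Proof.
move=> fq; pose g (s : R) := f (x + s *: d).
have dg (t : R) : is_derive t 1 g (dotv (q (x + t *: d)) d).
  exact: is_derive_line.
have cg : {within `[0, 1], continuous g}.
  apply: derivable_within_continuous => t _; exact: ex_derive.
have [c] := @MVT_segment R g (fun t => dotv (q (x + t *: d)) d) 0 1 ler01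
  (fun t _ => dg t) cg.
rewrite in_itv /= /g scale1r scale0r addr0 subr0 mulr1 => c01 ->.
by exists c.
Qed.

(** The mean value theorem is applied to f(z) - L/2 |z - x|^2. Its slope along [d] is at most <grad
    f x, d>, because the gradient moves by at most L c |d| between x and x + c d. This gives the
    constant L/2 without an integral. *)
Lemma descent_lemma f (L : R) x d : (forall z, differentiable f z) ->
  lipschitz_grad f L ->
  f (x + d) <= f x + dotv (grad f x) d + L / 2 * enorm d ^+ 2.
Proof.
move=> df Lf; pose g z := f z + (- L) / 2 * enorm (z - x) ^+ 2.
have [z|c /andP[c0 _]] := @mvt_line g (fun z => grad f z + (- L) *: (z - x)) x d.
  by apply: has_gradD (has_grad_half_sqr_dist _ _ _); apply: has_grad_grad.
rewrite /g subrr enorm0 (addr_subC x d).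
rewrite (addr_subC x (c *: d)).
rewrite dotvDl scalerA !dotvZl -sqr_enorm => E.
have := Lf (x + c *: d) x; rewrite (addr_subC x) enormZ ger0_norm //.
move: (grad f (x + c *: d)) (grad f x) E => a b E ab.
have := le_trans (dotv_le (a - b) d) (ler_wpM2r (enorm_ge0 d) ab).
by rewrite dotvBl; lra.
Qed.

(** The Jacobian is compared with a difference quotient of [F], up to an arbitrary slack [e]. *)
Lemma opbound_jac_lipschitz F x (L : R) :
  (forall y z, enorm (F y - F z) <= L * enorm (y - z)) ->
  differentiable F x -> opbound (jac F x) L.
Proof.
move=> FL dFx v; have [v0|v0] := eqVneq (enorm v) 0.
  by rewrite (enorm_eq0 v0) mulmx0 enorm0 mulr0.
have {v0} v0 : 0 < enorm v by rewrite lt_def v0 enorm_ge0.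
rewrite -ler_pdivrMr //; apply/ler_addgt0Pr => e e0.
rewrite ler_pdivrMr //.
have [r r0 Hr] := jac_eps dFx e0.
(* Scaled so that [t *: v] has norm r/2, inside the radius where the linearization is accurate. *)
pose t := r / 2 / enorm v; have t0 : 0 < t by rewrite !divr_gt0.
have tv : enorm (t *: v) = t * enorm v by rewrite enormZ gtr0_norm.
have := Hr (t *: v); rewrite {1}tv divfK ?gt_eqF // ltr_pdivrMr //.
rewrite ltr_pMr // ltr1n => /(_ isT) H.
rewrite -(ler_pM2l t0) -{1}(gtr0_norm t0) -enormZ scalemxAr.
have := enorm_le_add (jac F x *m (t *: v)) (F (x + t *: v) - F x).
rewrite (enormC (_ *m _)); have := FL (x + t *: v) x; rewrite (addr_subC x).
rewrite tv in H *; lra.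
Qed.

(** The bound holds at points of differentiability and survives both the limits in [BJac] and convex
    combinations. *)
Lemma opbound_ClarkeJac F x (L : R) M :
  (forall y z, enorm (F y - F z) <= L * enorm (y - z)) ->
  ClarkeJac F x M -> opbound M L.
Proof.
move=> FL [m [lam [Ms [lam0 [lam1 [MsB ->]]]]]].
have B i : opbound (Ms i) L.
  move=> v; apply/ler_addgt0Pr => e e0.
  have [y [dy [_ yM]]] := MsB i.
  have c0 : 0 < n%:R ^+ 2 * enorm v + 1.
    by rewrite ltr_wpDl // mulr_ge0 ?sqr_ge0 ?enorm_ge0.
  have /cvgrPdist_lt /(_ _ (divr_gt0 e0 c0)) [N _ /(_ N (leqnn N))] /= := yM.
  rewrite ltr_pdivlMr // => H.
  have := enorm_le_add (Ms i *m v) (jac F (y N) *m v); rewrite -mulmxBl.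
  have := opbound_jac_lipschitz FL (dy N) v.
  have := enorm_mulmx_le_norm (Ms i - jac F (y N)) v.
  move: H; have := normr_ge0 (Ms i - jac F (y N)); set a := `|_ - _|.
  
  set X := n%:R ^+ 2; set c := enorm (jac _ _ *m v).
  nra.
move=> v; rewrite mulmx_suml; apply: le_trans (enorm_sum _ _) _.
rewrite -[L]mul1r -lam1 !mulr_suml; apply: ler_sum => i _.
by rewrite -scalemxAl enormZ ger0_norm // -mulrA ler_wpM2l ?B.
Qed.

End Calculus.

(** * Trust-region methods *)

Section TrustRegion.
Context {R : realType} {n : nat}.
Context (phi : 'cV[R]_n -> R) (q : 'cV[R]_n -> 'cV[R]_n).
Context (x d : nat -> 'cV[R]_n) (delta pred : nat -> R) (B : nat -> 'M[R]_n).
Context (mu1 mu2 c1 c2 c3 beta lb K C : R).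
Let ratio k := (phi (x k) - phi (x k + d k)) / pred k.
Hypothesis phi_grad : forall z, has_grad phi z (q z).
Hypothesis phi_lb : forall z, lb <= phi z.
Hypothesis sublevel_bounded : forall z, phi z <= phi (x 0%N) -> enorm z <= K.
Hypothesis q_unif : forall (r e : R), 0 < e -> exists2 s : R, 0 < s &
  forall y z, enorm y <= r -> enorm (z - y) < s -> enorm (q z - q y) <= e.
Hypothesis C_gt0 : 0 < C.
Hypothesis B_bound : forall k, opbound (B k) C.
Hypothesis delta0_gt0 : 0 < delta 0%N.
Hypotheses (mu1_gt0 : 0 < mu1) (mu12 : mu1 < mu2) (mu2_lt1 : mu2 < 1).
Hypotheses (c1_gt0 : 0 < c1) (c12 : c1 < c2) (c2_lt1 : c2 < 1) (c3_gt1 : 1 < c3).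
Hypothesis beta_gt0 : 0 < beta.
Hypothesis predE : forall k,
  pred k = - (dotv (q (x k)) (d k) + 1 / 2 * dotv (B k *m d k) (d k)).
Hypothesis pred_ge : forall k,
  beta * enorm (q (x k)) * Num.min (delta k) (enorm (q (x k)) / C) <= pred k.
Hypothesis d_le : forall k, enorm (d k) <= delta k.
Hypothesis xS : forall k, x k.+1 = if ratio k < mu1 then x k else x k + d k.
Hypothesis deltaS : forall k, delta k.+1 =
  if ratio k < mu1 then c1 * delta k
  else if ratio k < mu2 then c2 * delta k else c3 * delta k.

Lemma delta_gt0 k : 0 < delta k.
Proof.
elim: k => [//|k IH]; rewrite deltaS.
have c20 := lt_trans c1_gt0 c12; have c30 := lt_trans ltr01 c3_gt1.
by case: ifP => _; [|case: ifP => _]; apply: mulr_gt0.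
Qed.

Lemma pred_ge_eps k e : 0 < e -> e <= enorm (q (x k)) ->
  beta * e * Num.min (delta k) (e / C) <= pred k.
Proof.
move=> e0 eq; apply: le_trans (pred_ge k).
have m0 : 0 <= Num.min (delta k) (e / C).
  by rewrite le_min !ltW ?delta_gt0 ?divr_gt0.
apply: ler_pM => //; [by rewrite mulr_ge0 ?ltW | by rewrite ler_pM2l |].
by rewrite le_min !ge_min lexx /= ler_pM2r ?invr_gt0 // eq orbT.
Qed.

Lemma pred_ge0 k : 0 <= pred k.
Proof.
apply: le_trans (pred_ge k); rewrite !mulr_ge0 ?enorm_ge0 ?(ltW beta_gt0) //.
by rewrite le_min (ltW (delta_gt0 k)) divr_ge0 ?enorm_ge0 // ltW.
Qed.

Lemma success_decrease k : (ratio k < mu1) = false ->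
  mu1 * pred k <= phi (x k) - phi (x k.+1).
Proof.
move=> s; rewrite xS s; move: s; rewrite /ratio => /negbT; rewrite -leNgt.
have := pred_ge0 k; rewrite le_eqVlt => /orP[/eqP <-|p0].
  (* Division by zero returns 0: if [pred k] vanishes then the ratio is 0, below [mu1], and the step
     would have been rejected. *)
  by rewrite invr0 mulr0 leNgt mu1_gt0.
by rewrite ler_pdivlMr.
Qed.

Lemma phi_nonincreasing j k : (j <= k)%N -> phi (x k) <= phi (x j).
Proof.
move=> /subnK <-; elim: (k - j)%N => [//|i]; apply: le_trans.
rewrite addSn; case s : (ratio (i + j) < mu1); first by rewrite xS s.
rewrite -subr_ge0; apply: le_trans (success_decrease s).
by rewrite mulr_ge0 ?pred_ge0 ?ltW.
Qed.

Lemma iterates_bounded k : enorm (x k) <= K.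
Proof. exact/sublevel_bounded/phi_nonincreasing. Qed.

(** The values are nonincreasing and bounded below, so from some index on they stay within [s] of
    their infimum. *)
Lemma phi_cauchy s : 0 < s -> exists N, forall j k,
  (N <= j)%N -> (j <= k)%N -> phi (x j) - phi (x k) < s.
Proof.
move=> s0; pose S := range (phi \o x).
have hS : has_inf S.
  by split; [exists (phi (x 0%N)); exists 0%N | exists lb => _ [k _ <-]; exact: phi_lb].
have [_ [N _ <-] HN] := inf_adherent s0 hS; exists N => j k Nj jk.
have : inf S <= phi (x k) by apply: ge_inf; [case: hS | exists k].
by have := phi_nonincreasing Nj; rewrite /= in HN; lra.
Qed.

(** The actual decrease falls short of the predicted one by at most 2 eta delta: one eta delta for
    the change of gradient along the step, one for the curvature term. By the choice of eta this is
    (1 - mu2) beta e delta, hence at most (1 - mu2) pred. *)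
Lemma small_radius_very_successful e : 0 < e -> exists2 D : R, 0 < D &
  forall k, e <= enorm (q (x k)) -> delta k <= D -> mu2 <= ratio k.
Proof.
move=> e0; pose eta := (1 - mu2) * beta * e / 2.
have eta0 : 0 < eta by rewrite !mulr_gt0 // subr_gt0.
have [s s0 Hs] := q_unif K eta0.
(* [s / 2] keeps the gradient change below eta, [e / C] makes the radius the smaller entry of the
   minimum in [pred_ge], and [eta / C] controls the curvature. *)
exists (Num.min (s / 2) (Num.min (e / C) (eta / C))) => [|k eq].
  by rewrite !lt_min; apply/and3P; split; apply: divr_gt0.
rewrite !le_min => /and3P[ds dC deta].
have dk0 := delta_gt0 k.
have := pred_ge_eps e0 eq; rewrite (min_l dC) => pe.
have p0 : 0 < pred k by apply: lt_le_trans pe; rewrite !mulr_gt0.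
rewrite /ratio ler_pdivlMr //.
have [c /andP[c0 c1'] E] := mvt_line (x k) (d k) phi_grad.
have cd : enorm (x k + c *: d k - x k) < s.
  rewrite addr_subC enormZ ger0_norm //.
  apply: (@le_lt_trans _ _ (delta k)); last by lra.
  by apply: le_trans (d_le k); rewrite ler_piMl ?enorm_ge0.
have {cd Hs} H := Hs _ _ (iterates_bounded k) cd.
have H1 : dotv (q (x k + c *: d k)) (d k) - dotv (q (x k)) (d k) <= eta * delta k.
  rewrite -dotvBl; apply: le_trans (dotv_le _ _) _.
  by apply: ler_pM => //; exact: enorm_ge0.
have H2 : - (1 / 2 * dotv (B k *m d k) (d k)) <= eta * delta k.
  have := dotv_le (- (B k *m d k)) (d k); rewrite dotvNl enormN => h.
  have {h} := le_trans h (ler_wpM2r (enorm_ge0 _) (B_bound k (d k))).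
  have := d_le k; have := enorm_ge0 (d k); rewrite ler_pdivlMr // in deta.
  set a := enorm (d k) => a0 ad.
  have : C * a * a <= C * delta k * delta k.
    by apply: ler_pM => //; rewrite ?ler_pM2l // mulr_ge0 // ltW.
  have := ler_wpM2r (ltW dk0) deta; set b := dotv _ _ => h1 h2 h3.
  have : 0 <= eta * delta k by rewrite mulr_ge0 ?ltW.
  lra.
have := ler_wpM2l (ltW (_ : 0 < 1 - mu2)) pe; rewrite subr_gt0 => /(_ mu2_lt1).
have -> : (1 - mu2) * (beta * e * delta k) = 2 * (eta * delta k) by rewrite /eta; field.
have := predE k; lra.
Qed.

(** If the gradient stayed above [e], radii would be bounded below and each accepted step would gain
    a fixed amount. Eventually every step would then be rejected, and the radii would tend to 0. *)
Lemma liminf_grad e N : 0 < e -> exists2 k, (N <= k)%N & enorm (q (x k)) < e.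
Proof.
move=> e0; apply: contrapT => H.
have {}H k : (N <= k)%N -> e <= enorm (q (x k)).
  by move=> Nk; rewrite leNgt; apply/negP => qe; apply: H; exists k.
have [D D0 HD] := small_radius_very_successful e0.
(* A radius at most [D] is enlarged by the very successful step that follows; a larger one shrinks
   by a factor no smaller than [c1]. *)
pose dm := Num.min (delta N) (c1 * D).
have dm0 : 0 < dm by rewrite lt_min delta_gt0 mulr_gt0.
have Hdm k : (N <= k)%N -> dm <= delta k.
  move=> /subnK <-; elim: (k - N)%N => [|i IH]; first by rewrite ge_min lexx.
  have di := delta_gt0 (i + N).
  rewrite addSn; have [iD|Di] := leP (delta (i + N)) D.
    have := HD _ (H _ (leq_addl i N)) iD => r2.
    rewrite deltaS ltNge (le_trans (ltW mu12) r2) ltNge r2 /=.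
    by apply: le_trans IH _; rewrite ler_peMl // ltW.
  apply: (@le_trans _ _ (c1 * D)); first by rewrite ge_min lexx orbT.
  apply: (@le_trans _ _ (c1 * delta (i + N))); first by rewrite ler_pM2l // ltW.
  rewrite deltaS; have c13 := lt_trans c12 (lt_trans c2_lt1 c3_gt1).
  by case: ifP => _ //; case: ifP => _; rewrite ler_pM2r // ltW.
pose s := mu1 * (beta * e * Num.min dm (e / C)).
have s0 : 0 < s by rewrite !mulr_gt0 // lt_min dm0 divr_gt0.
have [N1 HN1] := phi_cauchy s0.
pose M := maxn N N1.
have fail k : (M <= k)%N -> ratio k < mu1.
  rewrite geq_max => /andP[Nk N1k]; apply: contrapT => /negP/negbTE.
  move=> /success_decrease; have := HN1 k k.+1 N1k (leqnSn k).
  suff : s <= mu1 * pred k by lra.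
  rewrite ler_pM2l //; apply: le_trans (pred_ge_eps e0 (H k Nk)).
  rewrite ler_pM2l ?mulr_gt0 // le_min.
  by apply/andP; split; rewrite ge_min ?lexx ?orbT // Hdm.
(* Repeated rejection multiplies the radius by [c1 < 1] each time, contradicting the lower bound
   [dm]. *)
have geom i : delta (i + M) = geometric (delta M) c1 i.
  elim: i => [|i IH]; first by rewrite /= expr0 mulr1.
  by rewrite addSn deltaS fail ?leq_addl // IH /= exprS; ring.
have c1n : `|c1| < 1 by rewrite gtr0_norm // (lt_trans c12).
have /cvgrPdist_lt /(_ _ dm0) [i _ /(_ i (leqnn i))] := cvg_geometric (delta M) c1n.
rewrite sub0r normrN -geom gtr0_norm ?delta_gt0 // ltNge Hdm //.
by rewrite (leq_trans (leq_maxl N N1)) ?leq_addl.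
Qed.

(** From a late index k, follow the iterates to the first l with gradient below e'/2. The path is
    shorter than [r], so uniform continuity changes the gradient by at most e'/2 and its norm at k
    is at most e'. *)
Lemma trust_region_cvg : (fun k => enorm (q (x k))) @ \oo --> (0 : R).
Proof.
apply/cvgrPdist_le => e' e'0; pose e := e' / 2.
have e0 : 0 < e by rewrite divr_gt0.
have [r r0 Hr] := q_unif K e0.
pose m := mu1 * (beta * e).
have m0 : 0 < m by rewrite !mulr_gt0.
(* The entry [r] limits the distance travelled; the entry [e / C] forces the minimum in the
   predicted decrease to be the radius. *)
have [|N HN] := @phi_cauchy (m * Num.min r (e / C)).
  by rewrite mulr_gt0 // lt_min r0 divr_gt0.
exists N => // k /= Nk; rewrite sub0r normrN ger0_norm ?enorm_ge0 //.
have travel i : (forall j, (k <= j < i + k)%N -> e <= enorm (q (x j))) ->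
    m * enorm (x (i + k)%N - x k) <= phi (x k) - phi (x (i + k)%N).
  elim: i => [_|i IH Hi]; first by rewrite !subrr enorm0 mulr0.
  have {}IH : m * enorm (x (i + k)%N - x k) <= phi (x k) - phi (x (i + k)%N).
    by apply: IH => j /andP[kj ji]; rewrite Hi // kj addSn ltnW.
  rewrite addSn.
  case s : (ratio (i + k) < mu1); first by rewrite xS s.
  have dec := success_decrease s.
  have ei : e <= enorm (q (x (i + k)%N)) by rewrite Hi // leq_addl addSn /=.
  have := pred_ge_eps e0 ei; rewrite -(ler_pM2l mu1_gt0) mulrA -/m => pe.
  have := HN _ _ (leq_trans Nk (leq_addl i k)) (leqnSn (i + k)) => dlt.
  have {pe} pe : m * delta (i + k) <= mu1 * pred (i + k).
    (* If [e / C] were the smaller entry, this single step would decrease [phi] by at least m e/C,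
       more than [HN] leaves available. *)
    move: pe; have [|eC] := leP (delta (i + k)) (e / C); first by [].
    have : m * Num.min r (e / C) <= m * (e / C).
      by rewrite ler_pM2l // ge_min lexx orbT.
    lra.
  have := enorm_trans (x (i + k).+1) (x (i + k)%N) (x k).
  have -> : x (i + k).+1 - x (i + k)%N = d (i + k)%N by rewrite xS s addr_subC.
  move=> /(ler_wpM2l (ltW m0)); rewrite mulrDr.
  have := ler_wpM2l (ltW m0) (d_le (i + k)); lra.
have [l kl ql] := liminf_grad k e0.
have ex : exists l, (k <= l)%N && (enorm (q (x l)) < e) by exists l; rewrite kl.
(* Minimality of [l] keeps the gradient at least [e] at every index from k to l - 1, as [travel]
   requires. *)
case: (ex_minnP ex) => {kl ql} l /andP[kl ql] lmin.
have := travel (l - k)%N; rewrite subnK // => /(_ _) H.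
have {}H : m * enorm (x l - x k) <= phi (x k) - phi (x l).
  apply: H => j /andP[kj jl]; rewrite leNgt; apply/negP => qj.
  by have := lmin j; rewrite kj qj => /(_ isT); rewrite leqNgt jl.
have : enorm (x l - x k) < r.
  rewrite -(ltr_pM2l m0); apply: le_lt_trans H _.
  apply: lt_le_trans (HN _ _ Nk kl) _.
  by rewrite ler_pM2l // ge_min lexx.
move=> /(Hr _ _ (iterates_bounded k)).
by have := enorm_le_add (q (x k)) (q (x l)); rewrite enormC /e in ql *; lra.
Qed.

End TrustRegion.

(** * Proximal mapping of a weakly convex function *)

Section Prox.
Context {R : realType} {n : nat} {g : 'cV[R]_n -> \bar R} {rho gamma : R}.
Context {prox : 'cV[R]_n -> 'cV[R]_n}.
Hypotheses (g_proper : proper_fun g) (g_wcvx : weakly_convex rho g).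
Hypotheses (gamma_gt0 : 0 < gamma) (gamma_rho : gamma * rho < 1).
Hypothesis proxP : is_prox gamma g prox.
Implicit Types u v x y z : 'cV[R]_n.

Lemma lty_fin_num z : (g z < +oo)%E -> g z \is a fin_num.
Proof. by move=> gz; rewrite fin_numElt gz andbT; case: g_proper. Qed.

Lemma prox_fin_num x : g (prox x) \is a fin_num.
Proof.
apply: lty_fin_num; have [[z0 gz0] _] := g_proper.
have := proxP x z0; rewrite -(fineK (lty_fin_num gz0)) -EFinD => /le_lt_trans.
by move=> /(_ _ (ltry _)); case: (g (prox x)) => //= r _; exact: ltry.
Qed.

(** The quadratic terms combine through t|u|^2 + (1-t)|v|^2 - |z|^2 = t(1-t)|u-v|^2, which turns
    weak convexity into an inequality between real values of [g]. *)
Lemma weakly_convex_fine u v t : g u \is a fin_num -> g v \is a fin_num ->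
  0 < t < 1 -> let z := t *: u + (1 - t) *: v in g z \is a fin_num /\
  fine (g z) <= t * fine (g u) + (1 - t) * fine (g v)
    + rho / 2 * (t * (1 - t)) * enorm (u - v) ^+ 2.
Proof.
move=> gu gv t01 z; have := g_wcvx u v t01; rewrite -/z /=.
rewrite -(fineK gu) -(fineK gv) -!EFinD /= => H.
have gz : g z \is a fin_num.
  apply: lty_fin_num; have := le_lt_trans H (ltry _).
  by case: (g z) => //= r _; exact: ltry.
split=> //; move: H; rewrite -(fineK gz) -EFinD lee_fin /=.
have -> : enorm (u - v) ^+ 2 = dotv u u - 2 * dotv u v + dotv v v.
  by rewrite sqr_enorm !dotvE (dotvC v u); ring.
have -> : enorm z ^+ 2 = t ^+ 2 * dotv u u + 2 * t * (1 - t) * dotv u v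
    + (1 - t) ^+ 2 * dotv v v.
  by rewrite sqr_enorm /z !dotvE (dotvC v u); ring.
rewrite !sqr_enorm; lra.
Qed.

(** Quadratic growth of the strongly convex proximal objective around its minimizer. Minimality is
    tested at [t *: z + (1 - t) *: prox x]; after division by t, letting t tend to 0 gives the
    claim. *)
Lemma prox_strong_min x z : g z \is a fin_num ->
  fine (g (prox x)) + (2 * gamma)^-1 * enorm (prox x - x) ^+ 2
    + ((2 * gamma)^-1 - rho / 2) * enorm (z - prox x) ^+ 2
  <= fine (g z) + (2 * gamma)^-1 * enorm (z - x) ^+ 2.
Proof.
move=> gz; have gp := prox_fin_num x; set p := prox x in gp *.
set c := _ - rho / 2; set D := enorm (z - p) ^+ 2.
have c0 : 0 <= c * D.
  rewrite mulr_ge0 ?sqr_ge0 // subr_ge0 (mulrC rho) invfM ler_pM2l ?invr_gt0 //.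
  by rewrite -[gamma^-1]mul1r ler_pdivlMr // mulrC ltW.
apply/ler_addgt0Pr => e e0.
(* The inequality divided by t carries the error t c D, which this choice keeps at most [e]; the
   [+ 1] avoids dividing by zero. *)
pose t := Num.min (1 / 2) (e / (c * D + 1)).
have t0 : 0 < t by rewrite lt_min !divr_gt0 // ltr_wpDl.
have t1 : t < 1 by rewrite gt_min; apply/orP; left; lra.
have tc : t * (c * D) <= e.
  apply: (@le_trans _ _ (t * (c * D + 1))); first by rewrite ler_pM2l // lerDl.
  by rewrite -ler_pdivlMr ?ltr_wpDl // ge_min lexx orbT.
have t01 : 0 < t < 1 by rewrite t0.
have [gw W] := weakly_convex_fine gz gp t01; set w := t *: z + _ in gw W.
have := proxP x w; rewrite -/p -(fineK gp) -(fineK gw) -!EFinD lee_fin /= => M.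
have E : enorm (w - x) ^+ 2 =
    t * enorm (z - x) ^+ 2 + (1 - t) * enorm (p - x) ^+ 2 - t * (1 - t) * D.
  by rewrite /D !sqr_enorm /w !dotvE (dotvC p z) (dotvC x z) (dotvC x p); ring.
rewrite -(ler_pM2l t0); move: W M tc; rewrite E -/D div1r.
set a := fine (g z); set b := fine (g p); set A := enorm (z - x) ^+ 2.
set B := enorm (p - x) ^+ 2 => W M tc.
have : t * (t * (c * D)) <= t * e by rewrite ler_pM2l.
rewrite /c; lra.
Qed.

(** Adding the growth inequalities at [x] and [y] cancels the values of [g] and leaves strong
    monotonicity, (1 - gamma rho)|p - r|^2 <= <x - y, p - r>; Cauchy-Schwarz concludes. *)
Lemma prox_lipschitz x y :
  enorm (prox x - prox y) <= (1 - gamma * rho)^-1 * enorm (x - y).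
Proof.
have := prox_strong_min x (prox_fin_num y); have := prox_strong_min y (prox_fin_num x).
set p := prox x; set r := prox y; rewrite (enormC r p) => H1 H2.
have s0 : 0 < 1 - gamma * rho by rewrite subr_gt0.
rewrite mulrC ler_pdivlMr // mulrC.
have H : (1 - gamma * rho) * enorm (p - r) ^+ 2 <= dotv (x - y) (p - r).
  have {H1 H2} := lerD H1 H2; set a := fine _; set b := fine _.
  have -> : dotv (x - y) (p - r) = (enorm (r - x) ^+ 2 + enorm (p - y) ^+ 2
     - enorm (p - x) ^+ 2 - enorm (r - y) ^+ 2) / 2.
    rewrite !sqr_enorm !dotvE (dotvC r x) (dotvC p y) (dotvC p x) (dotvC r y).
    by field.
  set D := enorm (p - r) ^+ 2 => H.
  have := ler_wpM2l (ltW gamma_gt0) H.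
  have gE : gamma * (2 * gamma)^-1 = 1 / 2 by field; rewrite gt_eqF.
  rewrite !mulrDr !(mulrA gamma) mulrBr gE; lra.
have := dotv_le (x - y) (p - r); have := enorm_ge0 (p - r).
rewrite le_eqVlt => /orP[/eqP <-|D0]; first by move=> _; rewrite mulr0 enorm_ge0.
move=> /(le_trans H); rewrite expr2 mulrA ler_pM2r //.
Qed.

End Prox.

(** * Uniform continuity on bounded sets *)

Lemma heine_cantor_mx {R : realType} {n : nat} (F : 'cV[R]_n -> 'M[R]_n) (r e : R) :
  continuous F -> 0 < e -> exists2 s : R, 0 < s &
    forall y z, enorm y <= r -> enorm (z - y) < s -> `|F z - F y| < e.
Proof.
move=> cF e0.
(* A box of row vectors is compact and contains the transposes of all columns of norm at most [r];
   the argument runs through transposition. *)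
have cK : compact [set v : 'rV[R]_n | forall i, v ord0 i \in `[- r, r]].
  apply: (@rV_compact _ _ (fun=> `[- r, r]%classic)) => _.
  exact: segment_compact.
have e20 : 0 < e / 2 by rewrite divr_gt0.
(* The covering form of compactness, along radii tending to 0 from the right, turns a locally valid
   radius into a uniform one. *)
have /compact_near_coveringP/(_ R (0 : R)^'+
  (fun (s : R) (v : 'rV[R]_n) =>
    forall z, enorm (z - v^T) < s -> `|F z - F v^T| < e)) := cK.
case => [v _|]; last first.
  move=> s [/= s0 Hs]; exists (s / 2); first by rewrite divr_gt0.
  have s20 : 0 < s / 2 by rewrite divr_gt0.
  have s2s : `|0 - s / 2| < s.
    by rewrite sub0r normrN gtr0_norm // ltr_pdivrMr // ltr_pMr // ltr1n.
  move=> y z yr zy; have := Hs (s / 2) s2s s20 y^T; rewrite trmxK; apply => // i.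
  by rewrite in_itv /= -ler_norml mxE (le_trans (abs_coord_le_enorm _ _)).
(* Near [v], both [w] and any [z] within s/2 of it lie in the ball of radius [s] about [v], where
   [F] is e/2-close to its value at [v]. *)
have /cvgrPdist_lt /(_ _ e20) /nbhs_ballP[s /= s0 Hs] := cF v^T.
exists ([set w : 'rV[R]_n | ball v (s / 2) w], [set t : R | 0 < t < s / 2]) => /=.
  split; first by apply: nbhsx_ballx; rewrite divr_gt0.
  near=> t; apply/andP; split; near: t; [exact: nbhs_right_gt | apply: nbhs_right_lt].
  by rewrite divr_gt0.
move=> [w t] /= [vw /andP[t0 ts]] z zw.
have vw' : `|v^T - w^T| < s / 2.
  move: vw; rewrite -ball_normE /= => vw; apply: le_lt_trans vw.
  rewrite -linearB; apply: norm_mx_le => // i j; rewrite mxE norm_coord_le //.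
have B1 : ball v^T s w^T.
  by rewrite -ball_normE /= (lt_trans vw') // ltr_pdivrMr // ltr_pMr // ltr1n.
have B2 : ball v^T s z.
  rewrite -ball_normE /=; rewrite -(subrKA w^T) (le_lt_trans (ler_normD _ _)) //.
  rewrite [s]splitr ltrD // (le_lt_trans (norm_le_enorm _)) //.
  by rewrite enormC (lt_trans zw).
have /= h1 := Hs _ B1; have /= h2 := Hs _ B2.
rewrite -(subrKA (F v^T)).
rewrite (le_lt_trans (ler_normD _ _)) // (splitr e) ltrD //.
by rewrite distrC.
Unshelve. all: by end_near. Qed.

(** * Forward-backward envelope *)

Section ForwardBackwardEnvelope.
Context {R : realType} {n : nat}.
Context {f : 'cV[R]_n -> R} {g : 'cV[R]_n -> \bar R} {Lf rho gamma : R}.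
Context {prox : 'cV[R]_n -> 'cV[R]_n}.
Hypotheses (f_C2 : C2plus f) (Lf_ge0 : 0 <= Lf) (f_lip : lipschitz_grad f Lf).
Hypotheses (g_proper : proper_fun g) (g_wcvx : weakly_convex rho g).
Hypotheses (gamma_gt0 : 0 < gamma) (gamma_Lf : gamma * Lf < 1).
Hypothesis gamma_rho : gamma * rho < 1.
Hypothesis proxP : is_prox gamma g prox.
Implicit Types (u v w x y z h : 'cV[R]_n).

Definition fb_step x := prox (x - gamma *: grad f x).
Let T := fb_step.

(** The smooth part of the minimand defining the envelope; [g u] stays outside because it may be
    infinite. *)
Definition fb_model x u : R :=
  f x + dotv (grad f x) (u - x) + 1 / (2 * gamma) * enorm (u - x) ^+ 2.

(** This is Q^T R_gamma(x) with Q = I - gamma hess f(x). *)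
Definition fbe_grad x : 'cV[R]_n :=
  gamma^-1 *: (x - T x) - (hess f x)^T *m (x - T x).

(** Completing the square: up to a term independent of [u], the envelope minimizes the proximal
    objective at the forward step. *)
Lemma fb_model_square x u : fb_model x u =
  f x - gamma / 2 * enorm (grad f x) ^+ 2
  + 1 / (2 * gamma) * enorm (u - (x - gamma *: grad f x)) ^+ 2.
Proof.
rewrite /fb_model; move: (grad f x) (f x) => p a; rewrite opprB addrA addrAC.
move: (u - x) => v; rewrite !sqr_enorm !dotvE (dotvC v p).
by field; rewrite gt_eqF.
Qed.

Lemma fb_step_fin_num x : g (T x) \is a fin_num.
Proof. exact: prox_fin_num g_proper proxP _. Qed.

Lemma fb_step_min x u :
  ((fb_model x (T x))%:E + g (T x) <= (fb_model x u)%:E + g u)%E.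
Proof.
rewrite !fb_model_square; have := proxP (x - gamma *: grad f x) u.
rewrite -/(fb_step x) -/T -(fineK (fb_step_fin_num x)).
have := g_proper.2 u; case: (g u) => [b _| _ _ |//]; last by rewrite addey ?leey.
rewrite -!EFinD !lee_fin; lra.
Qed.

Lemma fbe_eq x : fbe gamma f g x = fb_model x (T x) + fine (g (T x)).
Proof.
rewrite /fbe (_ : ereal_inf _ = ((fb_model x (T x))%:E + g (T x))%E); last first.
  apply/eqP; rewrite eq_le; apply/andP; split.
    by apply: ereal_inf_lbound; exists (T x).
  by apply: le_ereal_inf_tmp => _ [u _ <-]; exact: fb_step_min.
by rewrite -(fineK (fb_step_fin_num x)).
Qed.

Lemma fbe_le_model x u : g u \is a fin_num ->
  fbe gamma f g x <= fb_model x u + fine (g u).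
Proof.
move=> gu; rewrite fbe_eq; have := fb_step_min x u.
by rewrite -(fineK gu) -(fineK (fb_step_fin_num x)) -!EFinD lee_fin.
Qed.

(** [T x] is a competitor in the minimization at [y], and [g (T x)] cancels. Exchanging [x] and [y]
    gives the matching lower bound. *)
Lemma fbe_sub_le x y :
  fbe gamma f g y - fbe gamma f g x <= fb_model y (T x) - fb_model x (T x).
Proof.
have := fbe_le_model y (fb_step_fin_num x); rewrite (fbe_eq x).
move: (fbe _ _ _ y) (fb_model y _) (fb_model x _) (fine _) => a b c k; lra.
Qed.

Lemma fbe_sub_ge x y :
  fb_model y (T y) - fb_model x (T y) <= fbe gamma f g y - fbe gamma f g x.
Proof.
have := fbe_sub_le y x.
move: (fbe _ _ _ y) (fbe _ _ _ x) (fb_model y _) (fb_model x _) => a b c k; lra.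
Qed.

Lemma fbe_le_objective x : ((fbe gamma f g x)%:E <= (f x)%:E + g x)%E.
Proof.
have := g_proper.2 x; case gx: (g x) => [b|//|//] _; last by rewrite addey ?leey.
have := @fbe_le_model x x; rewrite gx => /(_ isT).
by rewrite /fb_model subrr dotv0r enorm0 expr0n mulr0 !addr0 -EFinD lee_fin.
Qed.

Lemma objective_fb_step x : f (T x) + fine (g (T x))
  + ((2 * gamma)^-1 - Lf / 2) * enorm (x - T x) ^+ 2 <= fbe gamma f g x.
Proof.
rewrite fbe_eq /fb_model enormC div1r.
by have := descent_lemma x (T x - x) f_C2.1 f_lip; rewrite addrC subrK; lra.
Qed.

Lemma half_step_gap : 0 < (2 * gamma)^-1 - Lf / 2.
Proof.
rewrite subr_gt0 (mulrC Lf) invfM ltr_pM2l ?invr_gt0 //.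
by rewrite -[gamma^-1]mul1r ltr_pdivlMr // mulrC.
Qed.

Let LT := (1 - gamma * rho)^-1 * (1 + gamma * Lf).

Lemma LT_ge0 : 0 <= LT.
Proof.
by rewrite mulr_ge0 ?invr_ge0 ?subr_ge0 ?addr_ge0 ?mulr_ge0 // ltW.
Qed.

Lemma fb_step_lipschitz x y : enorm (T x - T y) <= LT * enorm (x - y).
Proof.
apply: le_trans (prox_lipschitz g_proper g_wcvx gamma_gt0 gamma_rho proxP _ _) _.
rewrite -mulrA ler_wpM2l ?invr_ge0 ?subr_ge0 ?(ltW gamma_rho) //.
have -> : x - gamma *: grad f x - (y - gamma *: grad f y) =
    (x - y) - gamma *: (grad f x - grad f y).
  by move: (grad f x) (grad f y) => a b; apply/colP => i; rewrite !mxE; ring.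
apply: le_trans (enormB _ _) _; rewrite enormZ gtr0_norm // mulrDl mul1r lerD2l.
by rewrite -mulrA ler_pM2l.
Qed.

(** [fb_model y u - fb_model x u], arranged to isolate the Taylor remainder of [f] and the increment
    of its gradient. *)
Definition fb_increment x y h u : R :=
  (f y - f x - dotv (grad f x) h)
  + dotv (grad f y - grad f x) (u - x) - dotv (grad f y - grad f x) h
  + 1 / (2 * gamma) * (dotv h h - 2 * dotv (u - x) h).

Lemma fb_model_sub x y h u : y - x = h ->
  fb_model y u - fb_model x u = fb_increment x y h u.
Proof.
move=> yx; rewrite /fb_model /fb_increment.
move: (grad f x) (grad f y) (f x) (f y) => a b c k.
have -> : u - y = (u - x) - h by rewrite -yx opprB subrKA.
move: (u - x) => v; rewrite !sqr_enorm !dotvE (dotvC h v); ring.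
Qed.

Lemma fbe_sub_bounds x y h : y - x = h ->
  fb_increment x y h (T y) <= fbe gamma f g y - fbe gamma f g x
    <= fb_increment x y h (T x).
Proof.
move=> yx; apply/andP; split.
  by rewrite -(fb_model_sub (T y) yx); exact: fbe_sub_ge.
by rewrite -(fb_model_sub (T x) yx); exact: fbe_sub_le.
Qed.

Let C := (Lf + gamma^-1) * LT + Lf + 1 / (2 * gamma).

(* [a], [G], [H], [v] stand for the first-order remainder of [f], the increment of
   [grad f], its linearization and [u - x]; the three groups of terms are bounded
   separately after writing [v = (v + w) - w]. *)
Lemma increment_core (a e : R) G H h w v : 0 <= e ->
  `|a| <= e * enorm h -> enorm (G - H) <= e * enorm h -> enorm G <= Lf * enorm h ->
  enorm (v + w) <= LT * enorm h ->
  `|a + dotv G v - dotv G h + 1 / (2 * gamma) * (dotv h h - 2 * dotv v h)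
    - (gamma^-1 * dotv w h - dotv H w)|
  <= e * (1 + enorm w) * enorm h + C * enorm h ^+ 2.
Proof.
move=> e0 ha hH hG hv; set D := enorm h in ha hH hG hv *.
have b1 : `|dotv (G - H) w| <= e * D * enorm w.
  by apply: le_trans (abs_dotv_le _ _) _; rewrite ler_wpM2r ?enorm_ge0.
have b2 : `|dotv G h| <= Lf * D ^+ 2.
  apply: le_trans (abs_dotv_le _ _) _; rewrite expr2 mulrA.
  by rewrite ler_wpM2r ?enorm_ge0.
have b3 : `|dotv (G - gamma^-1 *: h) (v + w)| <= (Lf + gamma^-1) * LT * D ^+ 2.
  apply: le_trans (abs_dotv_le _ _) _.
  have -> : (Lf + gamma^-1) * LT * D ^+ 2 = ((Lf + gamma^-1) * D) * (LT * D) by ring.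
  apply: ler_pM; rewrite ?enorm_ge0 //.
  by rewrite (le_trans (enormB _ _)) // enormZ gtr0_norm ?invr_gt0 // mulrDl lerD2r.
have hhE : dotv h h = D ^+ 2 by rewrite sqr_enorm.
have igE : 1 / (2 * gamma) = gamma^-1 / 2 by rewrite div1r invfM mulrC.
have b4 : `|1 / (2 * gamma) * D ^+ 2| <= 1 / (2 * gamma) * D ^+ 2.
  by rewrite ger0_norm // mulr_ge0 ?sqr_ge0 // divr_ge0 ?mulr_ge0 // ltW.
rewrite (_ : _ - _ = a - dotv (G - H) w + dotv (G - gamma^-1 *: h) (v + w)
    - dotv G h + 1 / (2 * gamma) * D ^+ 2); last first.
  by rewrite hhE igE !dotvE (dotvC h v) (dotvC h w); field; rewrite gt_eqF.
rewrite /C; apply: le_trans (ler_normD _ _) _.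
rewrite (_ : _ + _ * D ^+ 2 = e * D + e * D * enorm w
  + (Lf + gamma^-1) * LT * D ^+ 2 + Lf * D ^+ 2 + 1 / (2 * gamma) * D ^+ 2); last by ring.
apply: lerD b4; apply: le_trans (ler_normB _ _) _; apply: lerD b2.
apply: le_trans (ler_normD _ _) _; apply: lerD b3.
by apply: le_trans (ler_normB _ _) _; apply: lerD.
Qed.

(** Allowing any [u] within LT |h| of [T x] covers both [T x] and [T y], the two sides of the
    sandwich in [fbe_sub_bounds]. *)
Lemma fb_increment_near x y h u e : 0 <= e -> y - x = h ->
  `|f y - f x - dotv (grad f x) h| <= e * enorm h ->
  enorm (grad f y - grad f x - hess f x *m h) <= e * enorm h ->
  enorm (u - T x) <= LT * enorm h ->
  `|fb_increment x y h u - dotv (fbe_grad x) h|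
    <= e * (1 + enorm (x - T x)) * enorm h + C * enorm h ^+ 2.
Proof.
move=> e0 yx ha hH hu.
have -> : dotv (fbe_grad x) h =
    gamma^-1 * dotv (x - T x) h - dotv (hess f x *m h) (x - T x).
  rewrite /fbe_grad; move: (x - T x) => w.
  by rewrite dotvBl dotvZl dotv_mulmx_tr trmxK (dotvC w (_ *m _)).
apply: increment_core => //; first by rewrite -yx f_lip.
by rewrite subrKA.
Qed.

Lemma has_grad_fbe x : has_grad (fbe gamma f g) x (fbe_grad x).
Proof.
have LT0 := LT_ge0.
have C0 : 0 <= C.
  have ig0 : 0 <= gamma^-1 by rewrite invr_ge0 ltW.
  have i2g0 : 0 <= 1 / (2 * gamma) by rewrite divr_ge0 // mulr_ge0 // ltW.
  by apply: addr_ge0 i2g0; rewrite addr_ge0 // mulr_ge0 // addr_ge0.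
apply: (has_grad_quad_remainder C0) => e e0.
(* Cancels the factor 1 + |x - T x| in the bound of [fb_increment_near]. *)
pose e1 := e / (1 + enorm (x - T x)).
have w1 : 0 < 1 + enorm (x - T x) by rewrite ltr_pwDl ?enorm_ge0.
have e10 : 0 < e1 by rewrite divr_gt0.
have eE : e1 * (1 + enorm (x - T x)) = e by rewrite divfK // gt_eqF.
have [r1 r10 Hf] := has_grad_grad (f_C2.1 x) e10.
have [r2 r20 HG] := jac_eps (f_C2.2.1 x) e10.
exists (Num.min r1 r2) => [|h]; first by rewrite lt_min r10.
rewrite lt_min => /andP[/Hf {}Hf /HG {}HG].
move: Hf HG (addr_subC x h); move: (x + h) => y Hf HG yx.
have near u := @fb_increment_near x y h u _ (ltW e10) yx Hf HG.
have hTy : enorm (T y - T x) <= LT * enorm h by rewrite -yx fb_step_lipschitz.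
have hTx : enorm (T x - T x) <= LT * enorm h.
  by rewrite subrr enorm0 mulr_ge0 ?enorm_ge0.
have /andP[lo up] := fbe_sub_bounds yx.
have /ler_normlP[_ h1] := near _ hTx; have /ler_normlP[h2 _] := near _ hTy.
rewrite -eE; apply/ler_normlP; split.
  by apply: le_trans h2; rewrite lerN2 lerD2r.
by apply: le_trans h1; rewrite lerD2r.
Qed.

Lemma fbe_grad_sub y z : fbe_grad z - fbe_grad y =
  gamma^-1 *: ((z - T z) - (y - T y)) - (hess f z)^T *m ((z - T z) - (y - T y))
  - (hess f z - hess f y)^T *m (y - T y).
Proof.
rewrite /fbe_grad; move: (z - T z) (y - T y) (hess f z) (hess f y) => a b A B.
have -> : (A - B)^T = A^T - B^T by apply/matrixP => i j; rewrite !mxE.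
by rewrite mulmxBl mulmxBr scalerBr; apply/colP => i; rewrite !mxE; ring.
Qed.

(** The displacement x - T x is Lipschitz, hence bounded on balls, and the Hessian is bounded by
    [Lf] and uniformly continuous on balls. The difference of products in [fbe_grad_sub] is then
    small term by term. *)
Lemma fbe_grad_unif (r e : R) : 0 < e -> exists2 s : R, 0 < s &
  forall y z, enorm y <= r -> enorm (z - y) < s ->
    enorm (fbe_grad z - fbe_grad y) <= e.
Proof.
move=> e0; have LT0 := LT_ge0.
pose r' := Num.max r 0.
have r'0 : 0 <= r' by rewrite le_max lexx orbT.
(* Bounds |y - T y| on the ball by comparison with the origin. *)
pose W := (1 + LT) * (r' + 1) + enorm (T 0).
have W0 : 0 <= W by rewrite !addr_ge0 ?mulr_ge0 ?addr_ge0 ?enorm_ge0.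
have stepL y z : enorm (y - T y - (z - T z)) <= (1 + LT) * enorm (y - z).
  rewrite (_ : _ - _ = (y - z) - (T y - T z)); last first.
    by move: (T y) (T z) => a b; apply/colP => i; rewrite !mxE; ring.
  by rewrite (le_trans (enormB _ _)) // mulrDl mul1r lerD2l fb_step_lipschitz.
have stepB y : enorm y <= r' -> enorm (y - T y) <= W.
  move=> yr; have := enorm_le_add (y - T y) (0 - T 0); have := stepL y 0.
  rewrite sub0r enormN subr0 => h1 h2; apply: le_trans h2 _.
  rewrite addrC lerD2r; apply: le_trans h1 _.
  by rewrite ler_wpM2l ?addr_ge0 // (le_trans yr) // lerDl.
(* Closeness of Hessian entries for which the term with the Hessian difference is at most e/2. *)
pose eta := e / 2 / (n%:R ^+ 2 * W + 1).
have nW : 0 < n%:R ^+ 2 * W + 1 by rewrite ltr_wpDl // mulr_ge0 ?sqr_ge0.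
have eta0 : 0 < eta by rewrite !divr_gt0.
have [s1 s10 Hs] := heine_cantor_mx r f_C2.2.2.1 eta0.
pose M := (gamma^-1 + Lf) * (1 + LT) + 1.
have M0 : 0 < M.
  by rewrite ltr_wpDl // mulr_ge0 ?addr_ge0 // ?invr_ge0 // ltW.
exists (Num.min s1 (e / 2 / M)) => [|y z yr]; first by rewrite lt_min s10 !divr_gt0.
rewrite lt_min => /andP[/(Hs _ _ yr) {}Hs]; rewrite ltr_pdivlMr // => zy.
have yr' : enorm y <= r' by rewrite le_max yr.
have := stepB y yr'; have := stepL z y; rewrite fbe_grad_sub.
move: (z - T z) (y - T y) => wz wy wzy wyW.
have h1 : enorm ((hess f z)^T *m (wz - wy)) <= Lf * enorm (wz - wy).
  apply: opbound_tr => //; apply: opbound_jac_lipschitz => //; exact: f_C2.2.1.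
have h2 : enorm ((hess f z - hess f y)^T *m wy) <= e / 2.
  apply: le_trans (enorm_mulmx_le_norm _ _) _.
  apply: (@le_trans _ _ (n%:R ^+ 2 * eta * W)).
    apply: ler_pM => //; rewrite ?enorm_ge0 ?mulr_ge0 ?sqr_ge0 //.
    by rewrite ler_wpM2l ?sqr_ge0 // (le_trans (norm_trmx _)) // ltW.
  rewrite -mulrA (mulrC eta) mulrA.
  apply: (@le_trans _ _ ((n%:R ^+ 2 * W + 1) * eta)).
    by rewrite ler_pM2r // lerDl.
  by rewrite mulrC divfK ?gt_eqF.
have h3 : (gamma^-1 + Lf) * enorm (wz - wy) <= e / 2.
  apply: le_trans (ltW zy).
  apply: (@le_trans _ _ ((gamma^-1 + Lf) * ((1 + LT) * enorm (z - y)))).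
    by rewrite ler_wpM2l // addr_ge0 // invr_ge0 ltW.
  by rewrite mulrA (mulrC (enorm _)) ler_wpM2r ?enorm_ge0 // lerDl.
apply: le_trans (enormB _ _) _; rewrite (splitr e) lerD //.
apply: le_trans (enormB _ _) _; apply: le_trans h3.
by rewrite enormZ gtr0_norm ?invr_gt0 // mulrDl lerD2l.
Qed.

End ForwardBackwardEnvelope.

(** * Bounds on the model matrices and on sublevel sets of the envelope *)

Lemma cauchy_min_ge {R : realType} {n : nat} (delta a C : R) (B : 'M[R]_n) :
  0 < C -> 0 <= a -> opbound B C -> Num.min delta (a / C) <= cauchy_min delta a B.
Proof.
move=> C0 a0 BC; have /andP[op_ge0 op_le] := opnorm_bounds (ltW C0) BC.
rewrite /cauchy_min; case: eqP => [_|/eqP on0]; first by rewrite ge_min lexx.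
have o_gt0 : 0 < opnorm B by rewrite lt_def on0.
rewrite le_min ge_min lexx /= ge_min.
by rewrite orbC ler_wpM2l // lef_pV2.
Qed.

Lemma model_decrease {R : realType} {n : nat} (a : R) (p d : 'cV[R]_n) (B : 'M[R]_n) :
  model a p B 0 - model a p B d = - (dotv p d + 1 / 2 * dotv (B *m d) d).
Proof. by rewrite /model mulmx0 !dotv0r; ring. Qed.

Section FBEBounds.
Context {R : realType} {n : nat}.
Context {f : 'cV[R]_n -> R} {g : 'cV[R]_n -> \bar R} {Lf rho gamma : R}.
Context {prox : 'cV[R]_n -> 'cV[R]_n}.
Hypotheses (f_C2 : C2plus f) (Lf_ge0 : 0 <= Lf) (f_lip : lipschitz_grad f Lf).
Hypotheses (g_proper : proper_fun g) (g_wcvx : weakly_convex rho g).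
Hypotheses (gamma_gt0 : 0 < gamma) (gamma_Lf : gamma * Lf < 1).
Hypothesis gamma_rho : gamma * rho < 1.
Hypothesis proxP : is_prox gamma g prox.
Let T := @fb_step R n f gamma prox.

(** Q is bounded by 1 + gamma Lf and P by the Lipschitz constant of [prox]; the rest is sums and
    products of such bounds. *)
Lemma opbound_ntra_mx (x : 'cV[R]_n) P :
  ClarkeJac prox (x - gamma *: grad f x) P ->
  let Q := 1%:M - gamma *: hess f x in
  opbound (gamma^-1 *: (Q *m (1%:M - P *m Q)))
    (gamma^-1 * ((1 + gamma * Lf) * (1 + (1 - gamma * rho)^-1 * (1 + gamma * Lf)))).
Proof.
move=> PJ Q; have ig0 : 0 < gamma^-1 by rewrite invr_gt0.
have gL0 : 0 <= 1 + gamma * Lf by rewrite addr_ge0 // mulr_ge0 // ltW.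
have QB : opbound Q (1 + gamma * Lf).
  apply: opboundD opbound1 (opboundN _); rewrite -{2}(gtr0_norm gamma_gt0).
  apply: opboundZ; apply: opbound_jac_lipschitz f_lip _; exact: f_C2.2.1.
rewrite -{2}(gtr0_norm ig0); apply: opboundZ; apply: opboundM => //.
apply: opboundD opbound1 (opboundN _); apply: opboundM => //.
  by rewrite invr_ge0 subr_ge0 ltW.
apply: opbound_ClarkeJac PJ.
exact: prox_lipschitz g_proper g_wcvx gamma_gt0 gamma_rho proxP.
Qed.

(** The quadratic term is kept because it bounds |z - T z| on sublevel sets of the envelope. *)
Lemma fbe_lower_bound xs : (forall y, (f xs)%:E + g xs <= (f y)%:E + g y)%E ->
  forall z, f xs + fine (g xs)
    + ((2 * gamma)^-1 - Lf / 2) * enorm (z - T z) ^+ 2 <= fbe gamma f g z.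
Proof.
move=> xsmin z; apply: le_trans (objective_fb_step f_C2 f_lip g_proper gamma_gt0 proxP z).
rewrite lerD2r; have := xsmin (T z).
have gT : g (T z) \is a fin_num := fb_step_fin_num g_proper proxP z.
rewrite -(fineK gT) -EFinD.
have := g_proper.2 xs; case: (g xs) => [b _| _ |//]; last by rewrite addey.
by rewrite -EFinD lee_fin.
Qed.

Lemma fbe_sublevel_bounded x0 :
  (exists xs, forall y, ((f xs)%:E + g xs <= (f y)%:E + g y)%E) ->
  (exists M : R, forall y, ((f y)%:E + g y <= (f x0)%:E + g x0)%E -> enorm y <= M) ->
  exists K : R, forall z, fbe gamma f g z <= fbe gamma f g x0 -> enorm z <= K.
Proof.
move=> [xs xsmin] [M HM]; have c0 := half_step_gap gamma_gt0 gamma_Lf.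
pose lb := f xs + fine (g xs).
exists (M + ((fbe gamma f g x0 - lb) / ((2 * gamma)^-1 - Lf / 2) + 1)) => z zx0.
apply: le_trans (enorm_le_add z (T z)) _; apply: lerD.
  (* phi(T z) <= phi_gamma(z) <= phi_gamma(x0) <= phi(x0), so [T z] lies in the bounded sublevel set
     of phi. *)
  apply: HM; apply: le_trans (fbe_le_objective g_proper gamma_gt0 proxP x0).
  have gT : g (T z) \is a fin_num := fb_step_fin_num g_proper proxP z.
  rewrite -(fineK gT) -EFinD lee_fin; apply: le_trans zx0.
  apply: le_trans (objective_fb_step f_C2 f_lip g_proper gamma_gt0 proxP z).
  by rewrite lerDl mulr_ge0 ?sqr_ge0 // ltW.
(* The inequality a <= a^2 + 1 avoids a square root. *)
apply: (@le_trans _ _ (enorm (z - T z) ^+ 2 + 1)).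
  by have := sqr_ge0 (enorm (z - T z) - 1 / 2); lra.
rewrite lerD2r ler_pdivlMr // mulrC lerBrDl.
by apply: le_trans zx0; exact: fbe_lower_bound.
Qed.

End FBEBounds.

(** * Convergence of NTRA *)

Unset Implicit Arguments. Set Strict Implicit.

Theorem theorem4p7 (R : realType) (n : nat)
  (f : 'cV[R]_n -> R) (g : 'cV[R]_n -> \bar R) (Lf rho gamma : R)
  (prox : 'cV[R]_n -> 'cV[R]_n)
  (mu1 mu2 c1 c2 c3 beta : R)
  (x d : nat -> 'cV[R]_n) (delta : nat -> R) (P : nat -> 'M[R]_n) :
  (* problem data *)
  C2plus f -> 0 <= Lf -> lipschitz_grad f Lf ->
  proper_fun g -> lower_semicontinuous g -> 0 <= rho -> weakly_convex rho g ->
  (exists xs, forall y, ((f xs)%:E + g xs <= (f y)%:E + g y)%E) ->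
  (exists M : R, forall y, ((f y)%:E + g y <= (f (x 0%N))%:E + g (x 0%N))%E ->
       enorm y <= M) ->
  (* algorithm parameters *)
  0 < gamma -> gamma * Lf < 1 -> gamma * rho < 1 ->
  is_prox gamma g prox ->
  0 < delta 0%N -> 0 < mu1 -> mu1 < mu2 -> mu2 < 1 ->
  0 < c1 -> c1 < c2 -> c2 < 1 -> 1 < c3 ->
  (* the iterations of NTRA *)
  (let Q k := 1%:M - gamma *: hess f (x k) in
   let B k := gamma^-1 *: (Q k *m (1%:M - P k *m Q k)) in
   let phig := fbe gamma f g in
   let m k (dd : 'cV[R]_n) := model (phig (x k)) (grad phig (x k)) (B k) dd in
   let rk k := (phig (x k) - phig (x k + d k)) / (m k 0 - m k (d k)) in
   (forall k, ClarkeJac prox (x k - gamma *: grad f (x k)) (P k)) ->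
   (* the algorithm does not stop *)
   (forall k, ~ (Rgam gamma f prox (x k) = 0 /\
                 forall a, eigenvalue (B k) a -> 0 <= a)) ->
   (forall k, enorm (d k) <= delta k) ->
   (forall k, x k.+1 = if rk k < mu1 then x k else x k + d k) ->
   (forall k, delta k.+1 = if rk k < mu1 then c1 * delta k
                           else if rk k < mu2 then c2 * delta k
                           else c3 * delta k) ->
   0 < beta < 1 ->
   (forall k, m k 0 - m k (d k) >=
      beta * enorm (grad phig (x k)) *
      cauchy_min (delta k) (enorm (grad phig (x k))) (B k)) ->
   (fun k => enorm (grad phig (x k))) @ \oo --> (0 : R)).

Proof.
move=> f_C2 Lf0 f_lip g_proper _ _ g_wcvx argmin sublevel gamma0 gLf grho proxP.
move=> delta0 mu10 mu12 mu21 c10 c12 c21 c31 Q B phig m rk PJ _ d_le xS deltaS.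
move=> /andP[beta0 _] dec.
pose q := @fbe_grad R n f gamma prox.
have phi_grad z : has_grad phig z (q z).
  exact: has_grad_fbe f_C2 Lf0 f_lip g_proper g_wcvx gamma0 grho proxP z.
(* From here the explicit field [q] replaces [grad phig], so its uniform continuity applies to the
   trust-region argument. *)
have gradE z : grad phig z = q z := has_grad_unique (phi_grad z).
have [xs xsmin] := argmin.
have [K HK] := fbe_sublevel_bounded f_C2 f_lip g_proper gamma0 gLf proxP argmin sublevel.
have B_bound k := opbound_ntra_mx f_C2 Lf0 f_lip g_proper g_wcvx gamma0 grho proxP (PJ k).
set C := _ * (_ * _) in B_bound.
have C0 : 0 < C.
  have gL : 0 < 1 + gamma * Lf by rewrite ltr_wpDr // mulr_ge0 // ltW.
  rewrite !mulr_gt0 ?invr_gt0 // ltr_wpDr // mulr_ge0 ?(ltW gL) //.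
  by rewrite invr_ge0 subr_ge0 ltW.
have lbP z : f xs + fine (g xs) <= phig z.
  apply: le_trans (fbe_lower_bound f_C2 f_lip g_proper gamma0 proxP xsmin z).
  by rewrite lerDl mulr_ge0 ?sqr_ge0 // ltW // half_step_gap.
have q_unif := fbe_grad_unif f_C2 Lf0 f_lip g_proper g_wcvx gamma0 grho proxP.
have -> : (fun k => enorm (grad phig (x k))) = (fun k => enorm (q (x k))).
  by apply/funext => k; rewrite gradE.
apply: (@trust_region_cvg R n phig q x d delta (fun k => m k 0 - m k (d k)) B
  mu1 mu2 c1 c2 c3 beta _ K C phi_grad lbP HK q_unif C0 B_bound delta0
  mu10 mu12 mu21 c10 c12 c21 c31 beta0) => // k; first by rewrite /m gradE model_decrease.
(* Replacing [opnorm (B k)] by its uniform bound [C] only weakens the assumed decrease, giving the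
   form used by [trust_region_cvg]. *)
apply: le_trans (dec k); rewrite gradE ler_wpM2l ?mulr_ge0 ?enorm_ge0 ?(ltW beta0) //.
by apply: cauchy_min_ge; rewrite ?enorm_ge0 //; exact: B_bound.
Qed.
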